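(* Let $K$ be a number field of degree $d$. The following algorithm is correct. Input: a non-zero $x\in K$ and a real number $B>0$. With $L$, $X$, $N^+$, $N^-$ as defined in the context, the algorithm computes these objects and then, in its last step, for all row vectors $U\in\mathbb{Z}^r$ in the range $-XN^+\le U\le -XN^-$ (entrywise), tests whether $UL+X\ge 0$ (entrywise), and outputs $U$ if this is the case. Correctness means that the output is exactly the set of all row vectors $U\in\mathbb{Z}^r$ such that $UL+X\ge 0$. Furthermore, when the number field $K$ is fixed, the number of $U$ that need to be tested during the last step is at most proportional to $(\log N(x)-d\log B+1)^r$.
   Context: Let $K$ have $r_1$ real embeddings $\sigma_1,\dots,\sigma_{r_1}$ and $r_2$ pairs of complex conjugate embeddings, represented by $\sigma_{r_1+1},\dots,\sigma_{r_1+r_2}$; put $s=r_1+r_2$, $r=s-1$, so that $d=r_1+2r_2$. $N(x)=|N_{K/\mathbb{Q}}(x)|$ is the absolute norm. The logarithmic embedding $\ell:K^\times\to\mathbb{R}^s$ is $\ell(x)=(\log|\sigma_1(x)|,\dots,\log|\sigma_{r_1}(x)|,2\log|\sigma_{r_1+1}(x)|,\dots,2\log|\sigma_{r_1+r_2}(x)|)$, and for $B>0$ put $\mathcal{L}(B)=(\log B,\dots,\log B,2\log B,\dots,2\log B)$ ($r_1$ entries $\log B$ followed by $r_2$ entries $2\log B$). Inequalities between real matrices or vectors are entrywise. Let $u_1,\dots,u_r$ be generators of the unit group $\mathcal{O}_K^\times$ of the ring of integers of $K$ modulo torsion. - $L$ is the $r\times s$ matrix whose $i$-th row is $\ell(u_i)$.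 - $V=(1,\dots,1)^t\in\mathbb{Z}^s$ (column vector). - $M$ is the $s\times r$ matrix whose first $r$ rows form the inverse of the (invertible) $r\times r$ matrix obtained from $L$ by deleting its last column, and whose last row is zero. - $N^+$ is the $s\times r$ matrix whose $j$-th column is $M_{,j}-(\min_i M_{i,j})V$, and $N^-$ is the $s\times r$ matrix whose $j$-th column is $M_{,j}-(\max_i M_{i,j})V$, where $M_{,j}$ is the $j$-th column of $M$. - $X=\ell(x)-\mathcal{L}(B)$ (row vector in $\mathbb{R}^s$). (The problem being solved: finding all $U\in\mathbb{Z}^r$ with $UL+X\ge0$ is a reformulation, modulo torsion, of finding all units $u=\prod_i u_i^{U_i}$ with $|\sigma(xu)|\ge B$ for every embedding $\sigma:K\to\mathbb{C}$.)
   Formalization: The bound is proved with max(0, log N(x) − d log B + 1)^r in place of (log N(x) − d log B + 1)^r, since for odd r the latter can be negative while the number of tested U is 0. *)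

(* Defs.v *)
From mathcomp Require Import all_boot all_order all_algebra all_field.
From mathcomp Require Import finmap.
From mathcomp Require Import boolp classical_sets functions cardinality reals.
From mathcomp Require Import topology normedtype sequences exp.
From mathcomp Require Import complex.
Set Implicit Arguments.
Unset Strict Implicit.
Unset Printing Implicit Defensive.
Import Order.TTheory GRing.Theory Num.Theory.

Local Open Scope classical_set_scope.
Local Open Scope ring_scope.
Local Open Scope complex_scope.

(* A number field is a K : fieldExtType rat, and the complex numbers are R[i]
   for R : realType.  The number s of archimedean places is r.+1, so that r is
   the unit rank and the index ord_max denotes the last place. *)

(* The family sigma lists r1 real embeddings first, followed by one
   representative of each pair of complex conjugate embeddings. *)
Definition embedding_system (R : realType) (K : fieldExtType rat) (r1 r : nat)
    (sigma : 'I_r.+1 -> {rmorphism K -> R[i]}) : Prop :=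
  [/\ forall k : 'I_r.+1, (k < r1)%N ->
        forall y : K, complex.Im (sigma k y) = 0,
      forall k : 'I_r.+1, (r1 <= k)%N ->
        exists y : K, complex.Im (sigma k y) <> 0
    & forall tau : {rmorphism K -> R[i]}, exists! k : 'I_r.+1,
        (forall y : K, tau y = sigma k y) \/
        (forall y : K, tau y = (sigma k y)^*)].

Definition field_norm (K : fieldExtType rat) (x : K) : rat :=
  \det (passmx.mxof (vbasis {:K}) (vbasis {:K}) (amull x)).

Definition abs_norm (R : realType) (K : fieldExtType rat) (x : K) : R :=
  ratr `|field_norm x|.

Definition algebraic_integer (K : fieldExtType rat) (y : K) : Prop :=
  integralOver (intr : int -> K) y.

Definition integer_unit (K : fieldExtType rat) (y : K) : Prop :=
  [/\ y != 0, algebraic_integer y & algebraic_integer y^-1].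

Definition generates_units_mod_torsion (K : fieldExtType rat) (r : nat)
    (u : 'I_r -> K) : Prop :=
  (forall i, integer_unit (u i)) /\
  (forall v : K, integer_unit v ->
     exists (e : 'I_r -> int) (n : nat) (z : K),
       [/\ (0 < n)%N, z ^+ n = 1 & v = z * \prod_(i < r) u i ^ e i]).

Definition place_degree (r1 k : nat) : nat := if (k < r1)%N then 1%N else 2%N.

Definition log_embedding (R : realType) (K : fieldExtType rat) (r1 r : nat)
    (sigma : 'I_r.+1 -> {rmorphism K -> R[i]}) (x : K) : 'rV[R]_r.+1 :=
  \row_k ((place_degree r1 k)%:R * ln (Normc.normc (sigma k x))).

Definition log_bound (R : realType) (r1 r : nat) (B : R) : 'rV[R]_r.+1 :=
  \row_k ((place_degree r1 k)%:R * ln B).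

Definition mx_le (R : realType) (m n : nat) (A B : 'M[R]_(m, n)) : Prop :=
  forall i j, A i j <= B i j.

Definition matL (R : realType) (K : fieldExtType rat) (r1 r : nat)
    (sigma : 'I_r.+1 -> {rmorphism K -> R[i]}) (u : 'I_r -> K) :
    'M[R]_(r, r.+1) :=
  \matrix_(i < r) log_embedding r1 sigma (u i).

(* unlift ord_max i is None for the last index i, and otherwise Some of the
   same index seen in 'I_r; col' ord_max removes the last column. *)
Definition matM (R : realType) (r : nat) (L : 'M[R]_(r, r.+1)) :
    'M[R]_(r.+1, r) :=
  \matrix_(i, j)
    if unlift ord_max i is Some i' then invmx (col' ord_max L : 'M[R]_r) i' j
    else 0.

Definition matNplus (R : realType) (r : nat) (L : 'M[R]_(r, r.+1)) :
    'M[R]_(r.+1, r) :=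
  \matrix_(i, j) (matM L i j - \big[Num.min/matM L ord0 j]_k matM L k j).

Definition matNminus (R : realType) (r : nat) (L : 'M[R]_(r, r.+1)) :
    'M[R]_(r.+1, r) :=
  \matrix_(i, j) (matM L i j - \big[Num.max/matM L ord0 j]_k matM L k j).

Definition vecX (R : realType) (K : fieldExtType rat) (r1 r : nat)
    (sigma : 'I_r.+1 -> {rmorphism K -> R[i]}) (x : K) (B : R) :
    'rV[R]_r.+1 :=
  log_embedding r1 sigma x - log_bound r1 r B.

Definition passes_test (R : realType) (r : nat)
    (L : 'M[R]_(r, r.+1)) (X : 'rV[R]_r.+1) (U : 'rV[int]_r) : Prop :=
  mx_le 0 (map_mx intr U *m L + X).

(* The vectors U over which the last step of the algorithm loops. *)
Definition search_range (R : realType) (r : nat)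
    (L : 'M[R]_(r, r.+1)) (X : 'rV[R]_r.+1) : set 'rV[int]_r :=
  [set U | mx_le (- (X *m matNplus L)) (map_mx intr U) /\
           mx_le (map_mx intr U) (- (X *m matNminus L))].

Definition algorithm_output (R : realType) (r : nat)
    (L : 'M[R]_(r, r.+1)) (X : 'rV[R]_r.+1) : set 'rV[int]_r :=
  [set U | search_range L X U /\ passes_test L X U].

(* Main.v *)
(** The matrices [N+] and [N-] are right inverses of [L], because [L M = 1] and
    [L V = 0] (units have norm 1).  As [N+ >= 0 >= N-], multiplying [U L + X >= 0]
    by them gives [U + X N+ >= 0 >= U + X N-].  The [j]-th side of this box has
    length [(max_i M_ij - min_i M_ij) X V], where [X V = log N(x) - d log B].

    That [M] exists is the hard half of Dirichlet's unit theorem.  In the order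
    [Z[t]] of an integral primitive element [t], the pigeonhole principle gives, for
    a fixed place [k], nonzero elements of bounded norm that are arbitrarily small
    at all the other places.  Among a sequence of such elements, decreasing at all
    places but [k], two are congruent modulo a multiple of all the norms that occur;
    their quotient is a unit that is small at all places but [k].  The logarithms of
    these units form a diagonally dominant matrix. *)
From HB Require Import structures.
Require Import Defs.
From mathcomp Require Import all_boot all_order all_algebra all_field.
From mathcomp Require Import finmap.
From mathcomp Require Import boolp classical_sets functions cardinality reals.
From mathcomp Require Import topology normedtype sequences exp.
From mathcomp Require Import complex.
From mathcomp Require Import ring lra zify.
Set Implicit Arguments.
Unset Strict Implicit.
Unset Printing Implicit Defensive.
Import Order.TTheory GRing.Theory Num.Theory.
Local Open Scope classical_set_scope.
Local Open Scope ring_scope.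
Local Open Scope complex_scope.

(** * Embeddings of a number field *)

Lemma map_poly_intr (A B : nzRingType) (f : {rmorphism A -> B}) (m : {poly int}) :
  map_poly f (map_poly intr m) = map_poly intr m.
Proof. by apply/polyP=> i; rewrite !coef_map /= rmorph_int. Qed.

(* [t] is an algebraic integer generating [K], with minimal polynomial [m]. *)
Definition primitive_integer (K : fieldExtType rat) (t : K) (m : {poly int}) : Prop :=
  [/\ m \is monic, size m = (\dim {:K}).+1,
      separable_poly (map_poly intr m : {poly rat}),
      forall q : {poly rat},
        root (map_poly (in_alg K) q) t = (map_poly intr m %| q) &
      forall x : K, exists q : {poly rat}, x = (map_poly (in_alg K) q).[t]].

Lemma rat_primitive_minpoly (K : fieldExtType rat) (t : K) :
    <<1; t>>%VS = {:K}%VS ->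
  exists p : {poly rat}, [/\ p \is monic, size p = (\dim {:K}).+1,
    separable_poly p, root (map_poly (in_alg K) p) t &
    forall q : {poly rat}, root (map_poly (in_alg K) q) t -> p %| q].
Proof.
move=> gen_t.
have /polyOver1P[p def_p] := minPolyOver 1 t.
have mono_p : p \is monic by rewrite -(map_monic (in_alg K)) -def_p monic_minPoly.
have size_p : size p = (\dim {:K}).+1.
  rewrite -(size_map_poly (in_alg K)) -def_p size_minPoly.
  by rewrite -gen_t dim_Fadjoin dimv1 muln1.
have char0 : [pchar K] =i pred0.
  by move=> l; rewrite (pchar_lalg K) pchar_num.
exists p; split=> //.
- rewrite -(separable_map (in_alg K)) -def_p.
  exact: (pcharf0_separable 1%AS char0).
- by rewrite -def_p root_minPoly.
- move=> q rq; rewrite -(dvdp_map (in_alg K)) -def_p minPoly_dvdp //.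
  by apply/polyOver1P; exists q.
Qed.

(** In characteristic 0 there is a primitive element [t0]. Multiplying it by a common denominator
    [a] of its minimal polynomial makes it integral without changing the field it generates. *)
Lemma integral_primitive_element (K : fieldExtType rat) :
  exists (t : K) (m : {poly int}), primitive_integer t m.
Proof.
have sep : separable 1%AS {:K}%AS.
  apply/separableP=> y _; apply: pcharf0_separable => l.
  by rewrite (pchar_lalg K) pchar_num.
have gen0 := eq_adjoin_separable_generator sep (sub1v _).
set t0 := separable_generator _ _ in gen0.
have [p [mono_p size_p _ root_p _]] := rat_primitive_minpoly (esym gen0).
have [q [a nz_a def_p]] := rat_poly_scale p.
have nz_aQ : a%:~R != 0 :> rat by rewrite intr_eq0.
set d := \dim _ in size_p *.
pose t := a%:~R *: t0.
have gen_t : <<1; t>>%VS = {:K}%VS.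
  apply/eqP; rewrite eqEsubv subvf /= gen0.
  apply/FadjoinP; split; first exact: subv_adjoin.
  rewrite -[t0](scalerK nz_aQ).
  by apply: memvZ; exact: memv_adjoin.
have [p' [mono_p' size_p' sep_p' root_p' dvd_p']] := rat_primitive_minpoly gen_t.
(* [m] is [a ^ d * p('X / a)], a monic polynomial vanishing at [t = a * t0]. *)
pose m : {poly int} :=
  \poly_(i < d.+1) (if i == d then 1 else a ^+ (d.-1 - i) * q`_i).
(* As [q] is [a] times [p], one factor [a] is already contained in [q]; this is why [m] is written
   with exponent [d.-1 - i]. *)
have coef_m i : ((m`_i)%:~R : rat) = a%:~R ^+ (d - i) * p`_i.
  rewrite coef_poly ltnS; case: ltngtP => [lt_i_d|gt_i_d|->].
  - rewrite intrM rmorphXn /= def_p coefZ coef_map /= mulrA; congr (_ * _).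
    have d_gt0 := leq_ltn_trans (leq0n i) lt_i_d.
    by rewrite -[in RHS](prednK d_gt0) subSn ?exprSr ?mulfK // -ltnS prednK.
  - by rewrite nth_default ?mulr0 // size_p.
  - by rewrite subnn expr0 mul1r; move/monicP: mono_p; rewrite /lead_coef size_p.
have size_m : size m = d.+1.
  by rewrite size_poly_eq // eqxx oner_eq0.
have mono_m : m \is monic.
  by rewrite monicE lead_coefE size_m coef_poly ltnSn eqxx.
have root_m : root (map_poly (in_alg K) (map_poly intr m)) t.
  rewrite /root horner_coef size_map_poly size_map_inj_poly ?size_m //.
    2: exact: intr_inj.
  apply/eqP; transitivity ((a%:~R)%:A ^+ d * (map_poly (in_alg K) p).[t0]).
    2: by rewrite (rootP root_p) mulr0.
  rewrite horner_coef size_map_poly size_p mulr_sumr.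
  apply: eq_bigr => i _; rewrite !coef_map /= coef_m.
  have -> : t = (a%:~R)%:A * t0 by rewrite mulr_algl.
  rewrite exprMn !mulrA; congr (_ * _).
  by rewrite !exprZn !expr1n -!scalerAl !mul1r !scalerA mulrAC -exprD subnK // -ltnS.
(* Both polynomials are monic of the same degree and [p'] divides [m]. *)
have eq_mp : map_poly intr m = p'.
  apply/eqP; rewrite eq_sym -eqp_monic // ?monic_map //.
  rewrite -dvdp_size_eqp ?dvd_p' // size_p' size_map_inj_poly ?size_m //.
  exact: intr_inj.
exists t, m; split=> //.
- by rewrite eq_mp.
- move=> r; rewrite eq_mp; apply/idP/idP=> [/dvd_p' //|/dvdpP[h ->]].
  by rewrite rmorphM rootM root_p' orbT.
move=> x.
have /Fadjoin_polyP[f /polyOver1P[r ->] ->] : x \in <<1; t>>%VS by rewrite gen_t memvf.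
by exists r.
Qed.

Lemma primitive_integer_root (K : fieldExtType rat) (t : K) (m : {poly int}) :
  primitive_integer t m -> root (map_poly intr m) t.
Proof.
case=> _ _ _ /(_ (map_poly intr m)); rewrite dvdpp => mt _.
have eqm : map_poly intr m = map_poly (in_alg K) (map_poly intr m).
  exact/esym/(map_poly_intr (in_alg K)).
by rewrite eqm.
Qed.

(** Write each element as a polynomial in [t] and evaluate that polynomial at [z]. Two
    representatives differ by a multiple of [m], which vanishes at [z], so the choice does not
    matter. *)
Lemma embedding_of_root (K : fieldExtType rat) (C : numFieldType) (t : K)
    (m : {poly int}) (t_prim : primitive_integer t m)
    (z : C) (mz : root (map_poly intr m) z) :
  exists tau : {rmorphism K -> C}, tau t = z.
Proof.
have [_ _ _ m_dvd t_gen] := t_prim.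
pose g x := sval (cid (t_gen x)).
have gP x : (map_poly (in_alg K) (g x)).[t] = x by rewrite /g; case: cid.
pose f x := (map_poly ratr (g x)).[z].
have fE x q : x = (map_poly (in_alg K) q).[t] -> f x = (map_poly ratr q).[z].
  move=> def_x; apply/eqP; rewrite -subr_eq0 -hornerN -hornerD -rmorphB.
  have: root (map_poly (in_alg K) (g x - q)) t.
    by rewrite /root rmorphB hornerD hornerN gP def_x subrr.
  rewrite m_dvd => /dvdpP[h ->]; rewrite rmorphM hornerM /= map_poly_intr.
  by rewrite (rootP mz) mulr0.
have f_add : zmod_morphism f.
  move=> x y; rewrite (fE _ (g x - g y)) ?rmorphB ?hornerD ?hornerN //.
  by rewrite !gP.
have f_mul : monoid_morphism f.
  split; first by rewrite (fE _ 1) rmorph1 hornerC.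
  by move=> x y; rewrite (fE _ (g x * g y)) ?rmorphM ?hornerM // !gP.
pose fM : {rmorphism K -> C} := HB.pack f
  (GRing.isZmodMorphism.Build K C f f_add) (GRing.isMonoidMorphism.Build K C f f_mul).
by exists fM; rewrite /= (fE _ 'X) map_polyX hornerX.
Qed.

Lemma rmorph_horner_in_alg (K : fieldExtType rat) (C : numFieldType)
    (f : {rmorphism K -> C}) (q : {poly rat}) (t : K) :
  f (map_poly (in_alg K) q).[t] = (map_poly ratr q).[f t].
Proof.
rewrite -horner_map -map_poly_comp; congr _.[_].
apply: eq_map_poly => a /=.
exact: (fmorph_eq_rat (f \o in_alg K)).
Qed.

Lemma primitive_integer_roots (K : fieldExtType rat) (C : numClosedFieldType)
    (t : K) (m : {poly int}) :
    primitive_integer t m ->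
  exists rs : seq C, [/\ uniq rs, size rs = \dim {:K} &
    forall z, (z \in rs) = root (map_poly intr m) z].
Proof.
case=> m_monic size_m m_sep _ _.
have [rs def_m] := closed_field_poly_normal (map_poly intr m : {poly C}).
have mC_monic : map_poly intr m \is @monic C by rewrite monic_map.
rewrite (monicP mC_monic) scale1r in def_m.
exists rs; split=> [||z]; last by rewrite def_m root_prod_XsubC.
- rewrite -separable_prod_XsubC -def_m -(map_poly_intr (ratr : {rmorphism rat -> C})).
  by rewrite separable_map.
- apply: succn_inj; rewrite -size_m -(size_prod_XsubC _ (id : C -> C)) -def_m.
  by rewrite size_map_inj_poly //; apply: intr_inj.
Qed.

Lemma rmorph_primitive_root (K : fieldExtType rat) (C : numFieldType) (t : K)
    (m : {poly int}) (f : {rmorphism K -> C}) :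
  primitive_integer t m -> root (map_poly intr m) (f t).
Proof.
move/primitive_integer_root/rootP/(congr1 f).
by rewrite rmorph0 -horner_map (map_poly_intr f) => /rootP.
Qed.

(** The conjugates of [t] that belong to the place [k]; concatenated over all places, these lists
    will enumerate the roots of the minimal polynomial. *)
Definition place_values (R : realType) (K : fieldExtType rat) (r1 r : nat)
    (sigma : 'I_r.+1 -> {rmorphism K -> R[i]}) (t : K) (k : 'I_r.+1) : seq R[i] :=
  if (k < r1)%N then [:: sigma k t] else [:: sigma k t; (sigma k t)^*].

Lemma eq_conjc (R : realType) (z : R[i]) : z = z^* <-> complex.Im z = 0.
Proof.
case: z => a b; split=> [[] /= /eqP|/= ->]; last by rewrite oppr0.
by rewrite -subr_eq0 opprK -mulr2n mulrn_eq0 /= => /eqP.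
Qed.

(** An embedding is determined by its value at [t], so the roots of [m] correspond to the
    embeddings, and [embedding_system] sorts these into places. *)
Lemma perm_roots_places (R : realType) (K : fieldExtType rat) (r1 r : nat)
    (sigma : 'I_r.+1 -> {rmorphism K -> R[i]}) (t : K) (m : {poly int}) :
    embedding_system r1 sigma -> primitive_integer t m ->
  exists rs : seq R[i], [/\ uniq rs, size rs = \dim {:K},
    {in rs, forall z, root (map_poly intr m) z} &
    perm_eq rs [seq z | k <- enum 'I_r.+1, z <- place_values r1 sigma t k]].
Proof.
move=> [sig_re sig_im sig_all] t_prim.
have [rs [uniq_rs size_rs rs_root]] := primitive_integer_roots R[i] t_prim.
have [_ _ _ _ t_gen] := t_prim.
have tau_inj (tau tau' : {rmorphism K -> R[i]}) : tau t = tau' t -> tau =1 tau'.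
  by move=> eq_t x; have [q ->] := t_gen x; rewrite !rmorph_horner_in_alg eq_t.
have conj_re (k : 'I_r.+1) y : (k < r1)%N -> sigma k y = (sigma k y)^*.
  by move=> k_lt; apply/eq_conjc/sig_re.
exists rs; split=> // [z|]; first by rewrite rs_root.
have place_tau k z : z \in place_values r1 sigma t k ->
    exists2 tau : {rmorphism K -> R[i]}, z = tau t &
      (forall y, tau y = sigma k y) \/ (forall y, tau y = (sigma k y)^*).
  rewrite /place_values; case: ifP => _; rewrite !inE.
    by move/eqP->; exists (sigma k) => //; left.
  case/orP=> /eqP->; first by exists (sigma k) => //; left.
  by exists (conjc \o sigma k) => //; right.
apply: uniq_perm => // [|z].
  apply: allpairs_uniq_dep; rewrite ?enum_uniq //.
  (* No repetition within a complex place: if [sigma k t] were real, [sigma k] would equal its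
     conjugate on all of [K]. *)
  - move=> k _; rewrite /place_values; case: ltnP => //= le_r1_k; rewrite inE andbT.
    apply/eqP=> /(tau_inj (sigma k) (conjc \o sigma k)) eq_sig.
    have [y []] := sig_im k le_r1_k; apply/eq_conjc; exact: eq_sig.
  (* No repetition between places: a common value comes from a single embedding, which belongs to
     exactly one place. *)
  - move=> _ _ /allpairsPdep[k [z [_ kz ->]]] /allpairsPdep[k' [z' [_ kz' ->]]] /= eq_z.
    rewrite -eq_z in kz' *; suff -> : k = k' by [].
    have [tau def_z tauP] := place_tau _ _ kz.
    have [tau' def_z' tauP'] := place_tau _ _ kz'.
    have eq_tau := tau_inj tau' tau (etrans (esym def_z') def_z).
    have [k0 [_ k0_uniq]] := sig_all tau.
    rewrite -(k0_uniq k tauP); apply: k0_uniq.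
    by case: tauP' => tauP'; [left | right] => y; rewrite -eq_tau.
rewrite rs_root; apply/idP/allpairsPdep => [|[k [_ [_ /place_tau[tau -> _] ->]]]].
  case/(embedding_of_root t_prim)=> tau <-.
  have [k [tauP _]] := sig_all tau; exists k, (tau t); split=> //.
    by rewrite mem_enum.
  rewrite /place_values; case: ifP => k_r1; case: tauP => ->; rewrite !inE ?eqxx ?orbT //.
  by rewrite -conj_re.
exact: rmorph_primitive_root.
Qed.

(** The two values at a complex place contribute equally. The abstract [op] allows the use for sums,
    which count the embeddings, as well as for products, which give the norm. *)
Lemma big_places (R : realType) (K : fieldExtType rat) (r1 r : nat)
    (sigma : 'I_r.+1 -> {rmorphism K -> R[i]}) (t : K)
    (T : Type) (idx : T) (op : Monoid.com_law idx) (h : R[i] -> T) :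
    (forall z, h z^* = h z) ->
  \big[op/idx]_(z <- [seq z | k <- enum 'I_r.+1, z <- place_values r1 sigma t k]) h z =
  \big[op/idx]_(k < r.+1) iterop (place_degree r1 k) op (h (sigma k t)) idx.
Proof.
move=> h_conj; rewrite big_allpairs_dep.
rewrite big_enum; apply: eq_bigr => k _.
rewrite /place_values /place_degree; case: ifP => _; rewrite !big_cons big_nil /=.
  by rewrite Monoid.mulm1.
by rewrite Monoid.mulm1 h_conj.
Qed.

(** * The norm *)

(** The family [w] is kept general so as to cover both the basis that defines [field_norm] and the
    powers of [t]. *)
Lemma det_embeddings (K : fieldExtType rat) (C : numFieldType) (d : nat)
    (tau : 'I_d -> {rmorphism K -> C}) (t : K)
    (tau_inj : injective (fun i => tau i t))
    (w : 'I_d -> K)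
    (w_span : forall j : 'I_d, exists a : 'I_d -> rat, t ^+ j = \sum_l a l *: w l)
    (x : K) (A : 'M[rat]_d) (xw : forall j, x * w j = \sum_l A j l *: w l) :
  ratr (\det A) = \prod_i tau i x.
Proof.
have tauZ i a y : tau i (a *: y) = ratr a * tau i y.
  by rewrite -mulr_algl rmorphM /= -(fmorph_eq_rat (tau i \o in_alg K)).
(* [W] is invertible since it divides a Vandermonde matrix, and it conjugates [A]
   to the diagonal matrix of the [tau i x]. *)
pose W : 'M[C]_d := \matrix_(j, i) tau i (w j).
have detW : \det W != 0.
  pose V := Vandermonde d (\row_i tau i t).
  have [a aP] := choice w_span.
  have defV : V = (\matrix_(j, l) ratr (a j l)) *m W.
    apply/matrixP=> j i; rewrite !mxE -rmorphXn aP rmorph_sum.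
    by apply: eq_bigr => l _; rewrite tauZ !mxE.
  have: \det V != 0.
    rewrite det_Vandermonde; apply/prodf_neq0 => i _; apply/prodf_neq0 => j lt_ij.
    rewrite !mxE subr_eq0; apply: contraTneq lt_ij => /tau_inj->.
    by rewrite ltnn.
  by rewrite defV det_mulmx mulf_eq0 negb_or => /andP[].
have: map_mx ratr A *m W = W *m diag_mx (\row_i tau i x).
  apply/matrixP=> j i; rewrite mul_mx_diag !mxE -rmorphM mulrC xw rmorph_sum.
  by apply: eq_bigr => l _; rewrite tauZ !mxE.
move/(congr1 determinant); rewrite !det_mulmx mulrC => /(mulfI detW).
rewrite det_map_mx => ->; rewrite det_diag; apply: eq_bigr => i _.
by rewrite mxE.
Qed.

Lemma field_norm_embeddings (K : fieldExtType rat) (C : numFieldType)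
    (tau : 'I_(\dim {:K}) -> {rmorphism K -> C}) (t : K)
    (tau_inj : injective (fun i => tau i t)) (x : K) :
  ratr (field_norm x) = \prod_i tau i x.
Proof.
have basisK := vbasisP {:K}.
apply: (@det_embeddings _ _ _ _ _ tau_inj (fun j => (vbasis {:K})`_j)).
  move=> j; exists (fun l => coord (vbasis {:K}) l (t ^+ j)).
  exact: coord_basis basisK (memvf _).
move=> j; rewrite {1}(coord_basis basisK (memvf (x * _))).
apply: eq_bigr => l _; congr (_ *: _).
have := passmx.rVof_app (vbasis {:K}) basisK (amull x) (vbasis {:K})`_j.
by rewrite passmx.rVofE // -rowE => /rowP/(_ l); rewrite lfunE /= !mxE => ->.
Qed.

Lemma embeddings_of_roots (K : fieldExtType rat) (C : numFieldType) (t : K)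
    (m : {poly int}) (rs : seq C) (d : nat) :
    primitive_integer t m -> size rs = d ->
    {in rs, forall z, root (map_poly intr m) z} ->
  exists tau : 'I_d -> {rmorphism K -> C}, forall i, tau i t = rs`_i.
Proof.
move=> t_prim size_rs rs_root.
suff /choice[tau tauP] : forall i : 'I_d, exists f : {rmorphism K -> C}, f t = rs`_i.
  by exists tau.
move=> i; apply: (embedding_of_root t_prim); apply: rs_root.
by rewrite mem_nth // size_rs.
Qed.

(** The algebraic properties of the norm are proved with embeddings into [algC], where rational
    algebraic integers are known to be integers. *)
Lemma algC_embeddings (K : fieldExtType rat) (t : K) (m : {poly int}) :
    primitive_integer t m ->
  exists tau : 'I_(\dim {:K}) -> {rmorphism K -> algC}, injective (fun i => tau i t).
Proof.
move=> t_prim; have [rs [uniq_rs size_rs rs_root]] := primitive_integer_roots algC t_prim.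
have [|tau tauE] := embeddings_of_roots t_prim size_rs; first by move=> z; rewrite rs_root.
exists tau => i j; rewrite !tauE => /eqP; rewrite nth_uniq ?size_rs // => /eqP.
exact: val_inj.
Qed.

Lemma field_norm1 (K : fieldExtType rat) : field_norm (1 : K) = 1.
Proof.
have [t [m t_prim]] := integral_primitive_element K.
have [tau tau_inj] := algC_embeddings t_prim.
apply: (fmorph_inj (ratr : {rmorphism rat -> algC})).
rewrite /= (field_norm_embeddings tau_inj) rmorph1.
by apply: big1 => i _; rewrite rmorph1.
Qed.

Lemma field_normM (K : fieldExtType rat) (x y : K) :
  field_norm (x * y) = field_norm x * field_norm y.
Proof.
have [t [m t_prim]] := integral_primitive_element K.
have [tau tau_inj] := algC_embeddings t_prim.
apply: (fmorph_inj (ratr : {rmorphism rat -> algC})).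
rewrite rmorphM /= !(field_norm_embeddings tau_inj) -big_split.
by apply: eq_bigr => i _; rewrite rmorphM.
Qed.

(** The norm is a product of conjugates of [y], hence integral, and it is rational. *)
Lemma algebraic_integer_norm (K : fieldExtType rat) (y : K) :
  algebraic_integer y -> exists N : int, field_norm y = N%:~R.
Proof.
move=> int_y; have [t [m t_prim]] := integral_primitive_element K.
have [tau tau_inj] := algC_embeddings t_prim.
pose N := ratr (field_norm y) : algC.
have [p p_monic pN] : integralOver (intr : {rmorphism int -> algC}) N.
  rewrite /N (field_norm_embeddings tau_inj); elim/big_ind: _ => [|a b|i _].
  - exact: integral1.
  - exact: integral_mul.
  have [q q_monic qy] := int_y; exists q => //.
  by rewrite -(map_poly_intr (tau i)) /root horner_map (rootP qy) rmorph0.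
have: N \is a Num.int.
  apply: Cint_rat_Aint; first exact: Crat_rat.
  apply: (root_monic_Aint pN); first exact: monic_map.
  by apply/polyOverP=> i; rewrite coef_map /= intr_int.
case/intrP=> n def_N; exists n; apply: (fmorph_inj (ratr : {rmorphism rat -> algC})).
by rewrite /= -[LHS]/N def_N rmorph_int.
Qed.

Lemma integer_unit_norm (K : fieldExtType rat) (y : K) :
  integer_unit y -> `|field_norm y| = 1.
Proof.
case=> nz_y /algebraic_integer_norm[a Na] /algebraic_integer_norm[b Nb].
have: field_norm y * field_norm y^-1 = 1 by rewrite -field_normM divff // field_norm1.
rewrite Na Nb -intrM -[1]/(1%:~R) => /intr_inj ab1.
move/(congr1 absz)/eqP: ab1; rewrite abszM muln_eq1 => /andP[/eqP a1 _].
by rewrite -intr_norm -abszE a1.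
Qed.

(** * The order [Z[t]] *)

Definition in_order (K : fieldExtType rat) (t y : K) : Prop :=
  exists b : {poly int}, y = (map_poly intr b).[t].

Section InOrder.

Variables (K : fieldExtType rat) (t : K).

Lemma in_order_int (n : int) : in_order t n%:~R.
Proof. by exists n%:P; rewrite map_polyC hornerC. Qed.

Lemma in_orderD (x y : K) : in_order t x -> in_order t y -> in_order t (x + y).
Proof. by move=> [a ->] [b ->]; exists (a + b); rewrite rmorphD hornerD. Qed.

Lemma in_orderM (x y : K) : in_order t x -> in_order t y -> in_order t (x * y).
Proof. by move=> [a ->] [b ->]; exists (a * b); rewrite rmorphM hornerM. Qed.

Lemma in_orderX (n : nat) : in_order t (t ^+ n).
Proof. by exists 'X^n; rewrite map_polyXn hornerXn. Qed.

Lemma in_order_sum (n : nat) (F : 'I_n -> K) :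
  (forall i, in_order t (F i)) -> in_order t (\sum_i F i).
Proof.
move=> F_in; elim/big_ind: _ => // [|x y]; last exact: in_orderD.
exact: in_order_int 0.
Qed.

Lemma in_order_integral (m : {poly int}) (y : K) :
  primitive_integer t m -> in_order t y -> algebraic_integer y.
Proof.
move=> t_prim [b ->]; apply: (integral_horner (RtoK := (intr : {rmorphism int -> K}))).
  by move=> _ /(nthP 0)[i _ <-]; rewrite coef_map; apply: integral_id.
exists m; first by case: t_prim.
exact: primitive_integer_root t_prim.
Qed.

End InOrder.

(** That [x] divides its norm inside [Z[t]], and not only in the ring of integers, is what later
    keeps quotients of congruent elements in [Z[t]]. *)
Lemma order_norm (K : fieldExtType rat) (t : K) (m : {poly int}) (x : K) :
    primitive_integer t m -> in_order t x ->
  exists N : int, field_norm x = N%:~R /\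
    exists2 y, in_order t y & x * y = N%:~R.
Proof.
move=> t_prim [b def_x]; have [tau tau_inj] := algC_embeddings t_prim.
have [m_monic size_m _ _ _] := t_prim.
have mt := primitive_integer_root t_prim.
set d := \dim {:K} in tau tau_inj size_m.
have d_gt0 : (0 < d)%N by apply: adim_gt0.
(* Row [j] holds the coordinates of [x * t ^+ j] on the powers of [t]; they are integers because [m]
   is monic. *)
pose A : 'M[int]_d := \matrix_(j, l) (Pdiv.Ring.rmodp (b * 'X^j) m)`_l.
have xt (j : 'I_d) : x * t ^+ j = \sum_l (A j l)%:~R * t ^+ l.
  transitivity ((map_poly intr (b * 'X^j)).[t]).
    by rewrite rmorphM hornerM /= map_polyXn hornerXn -def_x.
  rewrite {1}(Pdiv.RingMonic.rdivp_eq m_monic (b * 'X^j)) rmorphD rmorphM /=.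
  rewrite hornerD hornerM (rootP mt) mulr0 add0r (@horner_coef_wide _ d).
    by apply: eq_bigr => l _; rewrite coef_map !mxE.
  apply: leq_trans (size_poly _ _) _.
  by rewrite -ltnS -size_m Pdiv.Ring.ltn_rmodpN0 ?monic_neq0.
have det_x : field_norm x = (\det A)%:~R.
  apply: (fmorph_inj (ratr : {rmorphism rat -> algC})).
  rewrite /= (field_norm_embeddings tau_inj) -det_map_mx.
  apply/esym/(det_embeddings tau_inj (w := fun j => t ^+ j)) => [j|j].
    exists (fun l => (l == j)%:R); rewrite (bigD1 j) //= eqxx scale1r big1 ?addr0 // => l.
    by move/negPf->; rewrite scale0r.
  by rewrite xt; apply: eq_bigr => l _; rewrite !mxE scaler_int mulrzl.
exists (\det A); split=> //.
pose i0 := Ordinal d_gt0.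
(* As [x] multiplies the vector of powers of [t] by [A], the first row of the
   adjugate of [A] expresses [\det A / x] in [Z[t]]. *)
exists (\sum_j (\adj A i0 j)%:~R * t ^+ j).
  by apply: in_order_sum => j; apply: in_orderM (in_order_int _ _) (in_orderX _ _).
pose T : 'cV[K]_d := \col_j t ^+ j.
have xT : x *: T = map_mx intr A *m T.
  by apply/matrixP=> j k; rewrite !mxE xt; apply: eq_bigr => l _; rewrite !mxE.
have: map_mx intr (\adj A) *m (x *: T) = (\det A)%:~R *: T.
  by rewrite xT mulmxA -map_mxM /= mul_adj_mx map_scalar_mx mul_scalar_mx.
move/matrixP/(_ i0 0); rewrite -scalemxAr !mxE expr0 mulr1 => <-.
by congr (_ * _); apply: eq_bigr => l _; rewrite !mxE.
Qed.

(** * The norm as a product over the places *)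

Lemma sum_place_degree (R : realType) (K : fieldExtType rat) (r1 r : nat)
    (sigma : 'I_r.+1 -> {rmorphism K -> R[i]}) :
  embedding_system r1 sigma -> (\sum_(k < r.+1) place_degree r1 k)%N = \dim {:K}.
Proof.
move=> sigmaP; have [t [m t_prim]] := integral_primitive_element K.
have [rs [_ <- _ rs_perm]] := perm_roots_places sigmaP t_prim.
rewrite -sum1_size (perm_big _ rs_perm) /= big_places //; apply: eq_bigr => k _.
by rewrite /place_degree; case: ifP.
Qed.

Lemma normc_prod (R : realType) (I : finType) (F : I -> R[i]) :
  Normc.normc (\prod_i F i) = \prod_i Normc.normc (F i).
Proof. exact: (big_morph _ (@Normc.normcM R) (@Normc.normc1 R)). Qed.

Lemma normc_conjc (R : realType) (z : R[i]) : Normc.normc z^* = Normc.normc z.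
Proof. by case: z => a b; rewrite /= sqrrN. Qed.

Lemma abs_norm_places (R : realType) (K : fieldExtType rat) (r1 r : nat)
    (sigma : 'I_r.+1 -> {rmorphism K -> R[i]}) (x : K) :
    embedding_system r1 sigma ->
  abs_norm R x = \prod_k Normc.normc (sigma k x) ^+ place_degree r1 k.
Proof.
move=> sigmaP; have [t [m t_prim]] := integral_primitive_element K.
have [rs [uniq_rs size_rs rs_root rs_perm]] := perm_roots_places sigmaP t_prim.
have [tau tauE] := embeddings_of_roots t_prim size_rs rs_root.
have tau_inj : injective (fun i => tau i t).
  move=> i j; rewrite !tauE => /eqP; rewrite nth_uniq ?size_rs // => /eqP.
  exact: val_inj.
have [_ _ _ _ /(_ x)[q def_x]] := t_prim.
have -> : abs_norm R x = Normc.normc (ratr (field_norm x)).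
  rewrite -(fmorph_eq_rat (real_complex R \o (ratr : {rmorphism rat -> R}))) /=.
  by rewrite expr0n addr0 sqrtr_sqr /abs_norm ratr_norm.
(* With [x] written as [q] evaluated at [t], its conjugates are the values of [q] at the roots of
   [m]. As [q] is rational, [h] is invariant under conjugation and [big_places] applies. *)
pose h (z : R[i]) : R := Normc.normc (map_poly ratr q).[z].
have h_conj z : h z^* = h z.
  rewrite /h -(normc_conjc _.[z]) -horner_map -map_poly_comp; congr (Normc.normc _.[_]).
  by apply: eq_map_poly => a; rewrite -(fmorph_eq_rat (conjc \o ratr)).
transitivity (\prod_(z <- rs) h z).
  rewrite (field_norm_embeddings tau_inj) normc_prod (big_nth 0) size_rs big_mkord.
  by apply: eq_bigr => i _; rewrite def_x rmorph_horner_in_alg tauE.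
rewrite (perm_big _ rs_perm) /= big_places //; apply: eq_bigr => k _.
rewrite /h -rmorph_horner_in_alg -def_x /place_degree.
by case: ifP.
Qed.

(** * Units that are small at all places but one *)

(** For each coordinate, the interval from [-W] to [W] is cut into [s] cells of length [2 * W / s].
    There are fewer boxes than points, so two points share a box. *)
Lemma pigeonhole_boxes (R : realType) (A P : finType) (s : nat) (W : R)
    (v : A -> P -> R) :
    (0 < s)%N -> (forall a p, `|v a p| < W) -> (s ^ #|P| < #|A|)%N ->
  exists a a', a != a' /\ forall p, `|v a p - v a' p| <= 2 * W / s%:R.
Proof.
case: s => // s _ vW ltPA.
(* The position rescaled to the interval from 0 to the number of cells. Since [v a p] is strictly
   below [W], the integer part is a valid cell index. *)
pose pos a p : R := (v a p + W) / (2 * W) * s.+1%:R.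
have W_gt0 a p : 0 < W := le_lt_trans (normr_ge0 _) (vW a p).
have pos_ge0 a p : 0 <= pos a p.
  have := vW a p; rewrite ltr_norml => /andP[lo _].
  rewrite mulr_ge0 // divr_ge0 //; first by rewrite -(subrK W 0) lerD2r sub0r ltW.
  by rewrite mulr_ge0 // ltW // (W_gt0 a p).
have pos_lt a p : pos a p < s.+1%:R.
  have := vW a p; rewrite ltr_norml => /andP[_ hi].
  rewrite -[ltRHS]mul1r ltr_pM2r ?ltr0Sn // ltr_pdivrMr ?mulr_gt0 ?(W_gt0 a p) //.
  by rewrite mul1r mulr_natl mulr2n ltrD2r.
pose key a : {ffun P -> 'I_s.+1} := [ffun p => inord (Num.truncn (pos a p))].
have /injectivePn[a [a' ne_aa' eq_key]] : ~~ injectiveb key.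
  apply: contraL ltPA => /injectiveP/leq_card; rewrite card_ffun card_ord.
  by rewrite -leqNgt.
exists a, a'; split=> // p.
move/ffunP/(_ p)/(congr1 (@nat_of_ord s.+1)): eq_key; rewrite !ffunE !inordK; first last.
- by rewrite -(ltr_nat R) (le_lt_trans _ (pos_lt a p)) // truncn_le.
- by rewrite -(ltr_nat R) (le_lt_trans _ (pos_lt a' p)) // truncn_le.
move=> eq_tr; have /andP[lo hi] := truncn_itv (pos_ge0 a p).
have /andP[lo' hi'] := truncn_itv (pos_ge0 a' p).
rewrite eq_tr in lo hi.
have W2_gt0 : 0 < 2 * W by rewrite mulr_gt0 // (W_gt0 a p).
have s_gt0 : 0 < s.+1%:R :> R by rewrite ltr0Sn.
have -> : v a p - v a' p = (2 * W / s.+1%:R) * (pos a p - pos a' p).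
  rewrite /pos -mulrBl -mulrBl opprD addrACA subrr addr0.
  rewrite mulrACA -mulrA [s.+1%:R^-1 * _]mulrC mulfV ?gt_eqF // mulr1.
  by rewrite mulrC divfK // gt_eqF.
rewrite normrM gtr0_norm ?divr_gt0 //; apply: ler_piMr; first by rewrite ltW ?divr_gt0.
rewrite ler_norml; apply/andP; split.
  rewrite lerBrDr; apply: le_trans (lo); rewrite addrC lerBlDr.
  by rewrite -natr1 in hi'; apply: ltW.
rewrite lerBlDr; apply: le_trans (ltW hi) _.
by rewrite -natr1 addrC lerD2l.
Qed.

Definition order_elt (K : fieldExtType rat) (t : K) (d : nat) (a : 'I_d -> int) : K :=
  \sum_i (a i)%:~R * t ^+ i.

Lemma in_order_elt (K : fieldExtType rat) (t : K) (d : nat) (a : 'I_d -> int) :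
  in_order t (order_elt t a).
Proof.
by apply: in_order_sum => i; apply: in_orderM (in_order_int _ _) (in_orderX _ _).
Qed.

Lemma order_eltB (K : fieldExtType rat) (t : K) (d : nat) (a b : 'I_d -> int) :
  order_elt t (fun i => a i - b i) = order_elt t a - order_elt t b.
Proof. by rewrite -sumrB; apply: eq_bigr => i _; rewrite intrB mulrBl. Qed.

(** A nonzero polynomial of degree less than that of [m] is not a multiple of [m]. *)
Lemma order_elt_eq0 (K : fieldExtType rat) (t : K) (m : {poly int})
    (a : 'I_(\dim {:K}) -> int) :
  primitive_integer t m -> order_elt t a = 0 -> a =1 fun=> 0.
Proof.
move=> [m_monic size_m _ m_dvd _] a0 i.
pose q : {poly rat} := \poly_(j < \dim {:K}) (oapp a 0 (insub j))%:~R.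
have coef_q (j : 'I_(\dim {:K})) : q`_j = (a j)%:~R.
  by rewrite coef_poly ltn_ord valK.
have: root (map_poly (in_alg K) q) t.
  rewrite /root (@horner_coef_wide _ (\dim {:K})).
    rewrite -[X in _ == X]a0; apply/eqP/eq_bigr => j _.
    rewrite coef_map coef_q; congr (_ * _); exact: (rmorph_int (in_alg K)).
  by rewrite size_map_poly size_poly.
rewrite m_dvd => mq; apply/eqP; rewrite -(intr_eq0 rat) -coef_q.
suff -> : q = 0 by rewrite coef0.
apply: contraTeq mq => nz_q; apply/negP => /(dvdp_leq nz_q).
rewrite leqNgt size_map_inj_poly //; last exact: intr_inj.
by rewrite size_m ltnS size_poly.
Qed.

Lemma place_degree_gt0 (r1 k : nat) : (0 < place_degree r1 k)%N.
Proof. by rewrite /place_degree; case: ifP. Qed.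

(** The pairs index the real coordinates at the places other than [k]: [false] stands for the real
    part and [true] for the imaginary part, which is kept at complex places only. *)
Lemma card_other_coordinates (r1 r : nat) (k : 'I_r.+1) :
  #|[pred p : 'I_r.+1 * bool | (p.1 != k) && (p.2 ==> (r1 <= p.1)%N)]| =
  (\sum_(j < r.+1 | j != k) place_degree r1 j)%N.
Proof.
rewrite -sum1_card.
rewrite -(pair_big_dep (fun j => j != k) (fun j b => b ==> (r1 <= j)%N)
  (fun _ _ => 1%N)) /=.
apply: eq_bigr => j _; rewrite big_mkcond big_bool /= /place_degree ltnNge.
by case: (r1 <= j)%N.
Qed.

Lemma normc_triangle (R : realType) (x y : R[i]) :
  Normc.normc (x + y) <= Normc.normc x + Normc.normc y.
Proof. exact: le_normcD. Qed.

Lemma normc_sum (R : realType) (I : finType) (F : I -> R[i]) :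
  Normc.normc (\sum_i F i) <= \sum_i Normc.normc (F i).
Proof.
elim/big_ind2: _ => [|x a y b xa yb|//]; first by rewrite Normc.normc0.
by apply: le_trans (normc_triangle _ _) _; apply: lerD.
Qed.

Lemma normc_ge_Re (R : realType) (z : R[i]) : `|complex.Re z| <= Normc.normc z.
Proof. by case: z => a b; rewrite /= -sqrtr_sqr ler_wsqrtr // lerDl sqr_ge0. Qed.

Lemma normc_ge_Im (R : realType) (z : R[i]) : `|complex.Im z| <= Normc.normc z.
Proof. by case: z => a b; rewrite /= -sqrtr_sqr ler_wsqrtr // lerDr sqr_ge0. Qed.

Lemma normc_le_ReIm (R : realType) (z : R[i]) :
  Normc.normc z <= `|complex.Re z| + `|complex.Im z|.
Proof.
case: z => a b /=; rewrite -[leRHS]ger0_norm ?addr_ge0 // -sqrtr_sqr ler_wsqrtr //.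
by rewrite sqrrD !real_normK ?num_real // addrAC lerDl mulrn_wge0 // mulr_ge0.
Qed.

Lemma normc_ge0 (R : realType) (z : R[i]) : 0 <= Normc.normc z.
Proof. by case: z => a b; apply: sqrtr_ge0. Qed.

Lemma normc_int (R : realType) (n : int) : Normc.normc (n%:~R : R[i]) = `|n|%:~R.
Proof.
rewrite -(rmorph_int (real_complex R)) /=.
by rewrite expr0n addr0 sqrtr_sqr intr_norm.
Qed.

Lemma normc_embedding_gt0 (R : realType) (K : fieldExtType rat)
    (f : {rmorphism K -> R[i]}) (y : K) :
  y != 0 -> 0 < Normc.normc (f y).
Proof.
move=> nz_y; rewrite lt_neqAle normc_ge0 andbT eq_sym.
by apply: contraNneq nz_y => /Normc.eq0_normc/eqP; rewrite fmorph_eq0.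
Qed.

Lemma order_elt_bound (R : realType) (K : fieldExtType rat) (t : K) (d Q : nat)
    (f : {rmorphism K -> R[i]}) (a : 'I_d -> int) :
    (forall i, `|a i| <= Q%:Z) ->
  Normc.normc (f (order_elt t a)) <= Q%:R * \sum_(i < d) Normc.normc (f (t ^+ i)).
Proof.
move=> aQ; rewrite rmorph_sum mulr_sumr; apply: le_trans (normc_sum _) _.
apply: ler_sum => i _; rewrite rmorphM Normc.normcM rmorph_int normc_int.
by rewrite ler_wpM2r ?normc_ge0 // -[Q%:R]/(Q%:Z%:~R) ler_int.
Qed.

(** The pigeonhole argument makes an element small away from [k] at the price of a large value at
    [k]. The two effects balance in the product, so that [C] depends neither on [k] nor on [n]. *)
Lemma small_order_element (R : realType) (K : fieldExtType rat) (r1 r : nat)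
    (sigma : 'I_r.+1 -> {rmorphism K -> R[i]}) (t : K) (m : {poly int}) :
    embedding_system r1 sigma -> primitive_integer t m ->
  exists C : R, 0 < C /\ forall (k : 'I_r.+1) (n : nat), (0 < n)%N ->
    exists a : 'I_(\dim {:K}) -> int,
    [/\ order_elt t a != 0,
        forall j, j != k -> Normc.normc (sigma j (order_elt t a)) <= C / n%:R &
        \prod_j Normc.normc (sigma j (order_elt t a)) ^+ place_degree r1 j <= C].
Proof.
move=> sigmaP t_prim; have sum_deg := sum_place_degree sigmaP.
have sig_re (j : 'I_r.+1) y : (j < r1)%N -> complex.Im (sigma j y) = 0.
  by case: sigmaP => re _ _ /re.
set d := \dim _ in sum_deg *.
have d_gt0 : (0 < d)%N by apply: adim_gt0.
pose h j := \sum_(i < d) Normc.normc (sigma j (t ^+ i)).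
have h_ge0 j : 0 <= h j by apply: sumr_ge0 => i _; apply: normc_ge0.
(* The summand 1 makes [H] strictly larger than every [h j], as the pigeonhole bound must be strict,
   and gives [1 <= H]. *)
pose H : R := 1 + \sum_j h j.
have H_ge1 : 1 <= H by rewrite lerDl sumr_ge0.
have hH j : h j < H.
  by rewrite /H (bigD1 j) //= addrCA ltrDl ltr_wpDr // sumr_ge0.
have H4_ge1 : 1 <= 4 * H by rewrite (le_trans H_ge1) // ler_peMl ?(le_trans ler01) // ler1n.
pose C := (4 * H) ^+ d.
have H4_leC : 4 * H <= C by rewrite -[leLHS]expr1 ler_weXn2l.
have C_gt0 : 0 < C by rewrite exprn_gt0 // (lt_le_trans ltr01).
exists C; split=> // k n n_gt0.
set e := place_degree r1 k.
have e_gt0 : (0 < e)%N := place_degree_gt0 r1 k.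
set mm := (\sum_(j < r.+1 | j != k) place_degree r1 j)%N.
have def_d : (e + mm)%N = d by rewrite -sum_deg (bigD1 k).
pose D (p : 'I_r.+1 * bool) := (p.1 != k) && (p.2 ==> (r1 <= p.1)%N).
pose P := {p : 'I_r.+1 * bool | D p}.
have cardP : #|{: P}| = mm by rewrite card_sig card_other_coordinates.
(* Coefficients range over [0 .. Q] and each of the [mm] real coordinates at the
   places other than [k] is cut into [s] boxes: [s ^ mm = Q ^ d < (Q + 1) ^ d]. *)
pose Q := (n ^ mm)%N; pose s := (n ^ d)%N.
have Q_gt0 : (0 < Q)%N by rewrite expn_gt0 n_gt0.
have s_gt0 : (0 < s)%N by rewrite expn_gt0 n_gt0.
pose elt (a : {ffun 'I_d -> 'I_Q.+1}) := order_elt t (fun i => (a i)%:Z).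
pose v a (p : P) : R := let z := sigma (val p).1 (elt a) in
  if (val p).2 then complex.Im z else complex.Re z.
have QhW j : Q%:R * h j < H * Q%:R by rewrite mulrC ltr_pM2r ?ltr0n.
have v_lt a p : `|v a p| < H * Q%:R.
  apply: le_lt_trans (QhW (val p).1); rewrite /v.
  have le_h := @order_elt_bound R K t d Q (sigma (val p).1) (fun i => (a i)%:Z).
  apply: le_trans (le_h _) => [|i]; last by rewrite ger0_norm // lez_nat -ltnS.
  by case: (val p).2; [apply: normc_ge_Im | apply: normc_ge_Re].
have card_lt : (s ^ #|{: P}| < #|{: {ffun 'I_d -> 'I_Q.+1}}|)%N.
  by rewrite cardP card_ffun !card_ord -expnM mulnC expnM ltn_exp2r.
have [a [a' [ne_aa' close]]] := pigeonhole_boxes s_gt0 v_lt card_lt.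
pose c i := (a i)%:Z - (a' i)%:Z.
have y_def : order_elt t c = elt a - elt a' by apply: order_eltB.
exists c.
have nR_gt0 : 0 < n%:R :> R by rewrite ltr0n.
(* The outer 2 counts the real and imaginary parts; each varies within a cell by at most [2 * W / s]
   with [W = H * Q]. Moreover [Q / s] is the inverse of [n ^ e], since [d = e + mm]. *)
have delta : 2 * (2 * (H * Q%:R) / s%:R) = 4 * H / n%:R ^+ e.
  rewrite /s /Q -def_d expnD natrM !natrX.
  field.
  by rewrite !expf_neq0 // gt_eqF.
have small j : j != k -> Normc.normc (sigma j (order_elt t c)) <= 4 * H / n%:R ^+ e.
  move=> ne_jk; rewrite -delta mulr_natl mulr2n y_def rmorphB.
  apply: le_trans (normc_le_ReIm _) _; apply: lerD.
    have Dj : D (j, false).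
      by rewrite /D /= ne_jk.
    by rewrite raddfB; apply: (close (exist (fun p => is_true (D p)) _ Dj)).
  case: (ltnP j r1) => [j_lt|j_ge].
    by rewrite -rmorphB sig_re // normr0 !mulr_ge0 ?invr_ge0 // (le_trans ler01).
  have Dj : D (j, true).
    by rewrite /D /= ne_jk.
  by rewrite raddfB; apply: (close (exist (fun p => is_true (D p)) _ Dj)).
(* The difference of two integers between 0 and [Q] is at most [Q] in absolute value, so no factor 2
   arises here. *)
have large : Normc.normc (sigma k (order_elt t c)) <= H * n%:R ^+ mm.
  rewrite -natrX; apply: le_trans (ltW (QhW k)).
  apply: order_elt_bound => i; rewrite /c ler_norml.
  have [] := (ltn_ord (a i), ltn_ord (a' i)); lia.
split.
- apply: contraNneq ne_aa' => /(order_elt_eq0 t_prim) c0.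
  apply/eqP/ffunP => i; apply/val_inj/eqP.
  by have /eqP := c0 i; rewrite subr_eq0.
- move=> j /small/le_trans; apply; apply: ler_pM => //.
  + by rewrite (le_trans ler01).
  + by rewrite invr_ge0 exprn_ge0.
  rewrite lef_pV2 ?posrE ?exprn_gt0 //.
  by rewrite -[leLHS]expr1 ler_weXn2l // ler1n.
rewrite (bigD1 k) //= -/e.
have le1 : Normc.normc (sigma k (order_elt t c)) ^+ e <= (H * n%:R ^+ mm) ^+ e.
  by rewrite lerXn2r ?nnegrE ?normc_ge0 // (le_trans (normc_ge0 _) large).
have le2 : \prod_(j < r.+1 | j != k)
    Normc.normc (sigma j (order_elt t c)) ^+ place_degree r1 j <= (4 * H / n%:R ^+ e) ^+ mm.
  rewrite /mm -prodrXr; apply: ler_prod => j ne_jk; rewrite exprn_ge0 ?normc_ge0 //=.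
  by rewrite lerXn2r ?nnegrE ?normc_ge0 ?small // (le_trans (normc_ge0 _) (small j ne_jk)).
apply: le_trans (ler_pM _ _ le1 le2) _; rewrite ?exprn_ge0 ?normc_ge0 //.
  by apply: prodr_ge0 => j _; rewrite exprn_ge0 ?normc_ge0.
have -> : (H * n%:R ^+ mm) ^+ e * (4 * H / n%:R ^+ e) ^+ mm = H ^+ e * (4 * H) ^+ mm.
  rewrite exprMn expr_div_n -!exprM mulnC mulrACA mulfV ?mulr1 //.
  by rewrite expf_neq0 // gt_eqF.
rewrite /C -def_d exprD ler_wpM2r ?exprn_ge0 ?(le_trans ler01) //.
by rewrite lerXn2r ?nnegrE ?(le_trans ler01) // ler_peMl ?(le_trans ler01) // ler1n.
Qed.

Lemma field_norm_eq0 (K : fieldExtType rat) (x : K) : (field_norm x == 0) = (x == 0).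
Proof.
have [->|nz_x] := eqVneq x 0.
  have [t [m t_prim]] := integral_primitive_element K.
  have [tau tau_inj] := algC_embeddings t_prim.
  rewrite -(fmorph_eq0 (ratr : {rmorphism rat -> algC})) /=.
  rewrite (field_norm_embeddings tau_inj) prodf_seq_eq0; apply/hasP.
  by exists (Ordinal (adim_gt0 {:K}%AS)); rewrite ?mem_index_enum //= rmorph0.
apply/negbTE/eqP => Nx0; have := field_normM x x^-1.
by rewrite divff // field_norm1 Nx0 mul0r => /eqP; rewrite oner_eq0.
Qed.

(* [x / y = 1 + (N / y) * (q * g)], and [N / y] lies in Z[t] when [N] is the norm of [y]. *)
Lemma in_order_quotient (K : fieldExtType rat) (t : K) (m : {poly int})
    (x y g : K) (N q : int) :
    primitive_integer t m -> in_order t y -> in_order t g -> y != 0 ->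
    field_norm y = N%:~R -> x - y = (N * q)%:~R * g ->
  in_order t (x / y).
Proof.
move=> t_prim y_in g_in nz_y Ny def_x.
have [N' [Ny' [y' y'_in yy']]] := order_norm t_prim y_in.
have eqN : N' = N by apply: (@intr_inj rat); rewrite -Ny' Ny.
have -> : x / y = 1%:~R + y' * (q%:~R * g).
  apply: (mulIf nz_y); rewrite divfK // mulrDl mul1r -[LHS](subrK y) addrC def_x.
  by rewrite intrM -eqN -yy'; congr (_ + _); ring.
apply: in_orderD (in_order_int _ _) (in_orderM y'_in _).
exact: in_orderM (in_order_int _ _) g_in.
Qed.

Lemma unit_small_at_other_places (R : realType) (K : fieldExtType rat) (r1 r : nat)
    (sigma : 'I_r.+1 -> {rmorphism K -> R[i]}) (k : 'I_r.+1) :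
    embedding_system r1 sigma ->
  exists y : K, integer_unit y /\ forall j, j != k -> Normc.normc (sigma j y) < 1.
Proof.
move=> sigmaP; have [t [m t_prim]] := integral_primitive_element K.
have [C [C_gt0 small]] := small_order_element sigmaP t_prim.
pose good (a : 'I_(\dim {:K}) -> int) := order_elt t a != 0 /\
  \prod_j Normc.normc (sigma j (order_elt t a)) ^+ place_degree r1 j <= C.
pose less (a b : 'I_(\dim {:K}) -> int) := forall j, j != k ->
  Normc.normc (sigma j (order_elt t b)) < Normc.normc (sigma j (order_elt t a)).
have next (a : {a | good a}) : exists b : {a | good a}, less (sval a) (sval b).
  case: a => a [nz_a a_le] /=.
  (* A sum in place of a maximum: [n] exceeds every quotient of [C] by a value of the current
     element, so [C / n] lies below all these values. *)
  pose n := (\sum_j (Num.truncn (C / Normc.normc (sigma j (order_elt t a)))).+1)%N.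
  have n_gt0 : (0 < n)%N by rewrite /n (bigD1 k).
  have [b [nz_b b_small b_le]] := small k n n_gt0.
  exists (exist _ b (conj nz_b b_le)) => j /b_small/le_lt_trans; apply => /=.
  have a_gt0 := normc_embedding_gt0 (sigma j) nz_a.
  rewrite ltr_pdivrMr ?ltr0n // mulrC -ltr_pdivrMr //.
  apply: lt_le_trans (truncnS_gt _) _.
  by rewrite ler_nat /n (bigD1 j) //= leq_addr.
have [a0 _] : exists a0 : {a | good a}, True.
  by have [a [nz_a _ a_le]] := small k 1%N isT; exists (exist _ a (conj nz_a a_le)).
have {next} [next nextP] := choice next.
pose f n := sval (iter n next a0).
have f_good n : good (f n) by apply: svalP.
have f_less i j : (i < j)%N -> less (f i) (f j).
  elim: j => // j IHj; rewrite ltnS leq_eqVlt => /orP[/eqP->|/IHj lt_ij].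
    exact: nextP.
  by move=> l ne_lk; apply: lt_trans (nextP _ l ne_lk) (lt_ij l ne_lk).
(* The norms along the sequence are nonzero integers of absolute value at most [B], so the factorial
   of [B] is a common multiple of them. *)
pose B := Num.truncn C.
have norm_dvd n : exists N q : int,
    field_norm (order_elt t (f n)) = N%:~R /\ (B`!)%:Z = N * q.
  have [nz_fn fn_le] := f_good n.
  have [N [def_N _]] := order_norm t_prim (in_order_elt t (f n)).
  have nz_N : N != 0 by rewrite -(intr_eq0 rat) -def_N field_norm_eq0.
  have N_le : (`|N| <= B)%N.
    rewrite /B truncn_ge_nat ?(ltW C_gt0) //.
    rewrite -(abs_norm_places _ sigmaP) /abs_norm def_N -intr_norm ratr_int in fn_le.
    by rewrite -[ `|N|%:R]/(`|N|%:Z%:~R) abszE.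
  have: (N %| (B`!)%:Z)%Z by rewrite dvdzE /= dvdn_fact // absz_gt0 nz_N.
  by case/dvdzP=> q def_q; exists N, q; rewrite mulrC.
pose M := B`!; have M_gt0 : (0 < M)%N := fact_gt0 B.
(* The residues of the coefficients modulo [M]; writing [M] as [M.-1.+1] makes the ordinal type
   visibly inhabited, as [inord] requires. *)
pose key (n : nat) : {ffun 'I_(\dim {:K}) -> 'I_M.-1.+1} :=
  [ffun i => inord `|(f n i %% M)%Z|%N].
have [i [j [lt_ij eq_key]]] : exists i j, (i < j)%N /\ key i = key j.
  pose T := {ffun 'I_(\dim {:K}) -> 'I_M.-1.+1}.
  have /injectivePn[i [j ne_ij eq_key]] : ~~ injectiveb (fun i : 'I_(#|T|.+1) => key i).
    by apply/negP => /injectiveP/leq_card; rewrite card_ord ltnn.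
  case: (ltngtP i j) => [lt_ij|lt_ji|/val_inj eq_ij].
  - by exists i, j.
  - by exists j, i.
  - by rewrite eq_ij eqxx in ne_ij.
have eq_mod l : exists g : int, f j l - f i l = M%:Z * g.
  move/ffunP/(_ l)/(congr1 (@nat_of_ord _)): eq_key; rewrite !ffunE.
  have M0 : M%:Z != 0 by rewrite -lt0n.
  rewrite !inordK ?prednK //; first last.
  - by rewrite -ltz_nat gez0_abs ?modz_ge0 // ltz_pmod.
  - by rewrite -ltz_nat gez0_abs ?modz_ge0 // ltz_pmod.
  move=> eq_abs; have eq_m : (f i l %% M)%Z = (f j l %% M)%Z.
    by rewrite -[LHS]gez0_abs ?modz_ge0 // eq_abs gez0_abs ?modz_ge0.
  exists ((f j l %/ M)%Z - (f i l %/ M)%Z).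
  by rewrite [f j l in LHS](divz_eq _ M) [f i l in LHS](divz_eq _ M) eq_m; ring.
have [g gP] := choice eq_mod.
have {}gP : order_elt t (f j) - order_elt t (f i) = M%:~R * order_elt t g.
  rewrite -order_eltB mulr_sumr; apply: eq_bigr => l _.
  by rewrite gP intrM mulrA.
have [[nz_i _] [nz_j _]] := (f_good i, f_good j).
have [Ni [qi [def_Ni def_M]]] := norm_dvd i.
have [Nj [qj [def_Nj def_M']]] := norm_dvd j.
(* The congruence modulo a multiple of both norms puts this quotient and its inverse in [Z[t]]. As
   [i < j], its numerator is the smaller one at every place but [k]. *)
exists (order_elt t (f j) / order_elt t (f i)); split.
  split; first by rewrite mulf_neq0 ?invr_neq0.
    apply: (in_order_integral t_prim).
    apply: (in_order_quotient t_prim _ (in_order_elt t g) nz_i def_Ni).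
      exact: in_order_elt.
    by rewrite gP def_M.
  rewrite invf_div; apply: (in_order_integral t_prim).
  apply: (in_order_quotient (q := qj) t_prim _ (in_order_elt t (fun l => - g l)) nz_j def_Nj).
    exact: in_order_elt.
  rewrite -def_M' -opprB gP -mulrN; congr (_ * _); rewrite -sumrN.
  by apply: eq_bigr => l _; rewrite rmorphN mulNr.
move=> l ne_lk; rewrite rmorphM fmorphV Normc.normcM Normc.normcV.
rewrite ltr_pdivrMr ?normc_embedding_gt0 // mul1r.
exact: f_less.
Qed.

(** * The logarithmic embedding *)

(** With these signs, a positive row sum says that the diagonal entry exceeds the sum of the
    absolute values of the others. The row of the coordinate of largest modulus of a nonzero kernel
    vector then gives a contradiction. *)
Lemma diagonally_dominant_unitmx (R : realType) (n : nat) (A : 'M[R]_n) :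
    (forall k j, j != k -> A k j <= 0) -> (forall k, 0 < \sum_j A k j) ->
  A \in unitmx.
Proof.
move=> off_le0 row_gt0; rewrite unitmxE unitfE -det_tr; apply/negP => /det0P[v nz_v vA0].
have /rV0Pn[i0 nz_i0] := nz_v.
have [k _ k_max] := Order.TotalTheory.arg_maxP (fun i => `|v 0 i|) (erefl : xpredT i0).
have vk_gt0 : 0 < `|v 0 k| by apply: lt_le_trans (k_max i0 isT); rewrite normr_gt0.
have: v 0 k * A k k + \sum_(j | j != k) v 0 j * A k j = 0.
  have /rowP/(_ k) := vA0; rewrite !mxE (bigD1 k) //= mxE => row0.
  rewrite -[RHS]row0; congr (_ + _).
  by apply: eq_bigr => j _; rewrite mxE.
move/eqP; rewrite addr_eq0 => /eqP/(congr1 Num.norm); rewrite normrN normrM => eq_norm.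
have: `|v 0 k| * `|A k k| <= `|v 0 k| * \sum_(j | j != k) - A k j.
  rewrite eq_norm mulr_sumr; apply: le_trans (ler_norm_sum _ _ _) _.
  apply: ler_sum => j ne_jk; rewrite normrM [ `|A k j|]ler0_norm ?off_le0 //.
  by apply: ler_wpM2r; [rewrite oppr_ge0 off_le0 | apply: k_max].
rewrite ler_pM2l // leNgt => /negP; apply; apply: lt_le_trans (ler_norm _).
by have := row_gt0 k; rewrite (bigD1 k) //= => lt0; rewrite sumrN -subr_gt0 opprK.
Qed.

Lemma log_embeddingE (R : realType) (K : fieldExtType rat) (r1 r : nat)
    (sigma : 'I_r.+1 -> {rmorphism K -> R[i]}) (x : K) (k : 'I_r.+1) :
  log_embedding r1 sigma x 0 k =
  (place_degree r1 k)%:R * ln (Normc.normc (sigma k x)).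
Proof. by rewrite mxE. Qed.

Section LogEmbedding.

Variables (R : realType) (K : fieldExtType rat) (r1 r : nat).
Variable sigma : 'I_r.+1 -> {rmorphism K -> R[i]}.

Let l := log_embedding r1 sigma.

Lemma log_embeddingM (x y : K) : x != 0 -> y != 0 -> l (x * y) = l x + l y.
Proof.
move=> nz_x nz_y; apply/rowP=> k; rewrite !mxE -mulrDr rmorphM Normc.normcM.
by rewrite lnM // posrE normc_embedding_gt0.
Qed.

Lemma log_embedding1 : l 1 = 0.
Proof. by apply/rowP=> k; rewrite !mxE rmorph1 Normc.normc1 ln1 mulr0. Qed.

Lemma log_embeddingV (x : K) : x != 0 -> l x^-1 = - l x.
Proof.
move=> nz_x; apply/eqP; rewrite -addr_eq0 -log_embeddingM ?invr_eq0 //.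
by rewrite mulVf // log_embedding1.
Qed.

Lemma log_embeddingXn (x : K) (n : nat) : x != 0 -> l (x ^+ n) = l x *+ n.
Proof.
move=> nz_x; elim: n => [|n IHn]; first by rewrite expr0 log_embedding1 mulr0n.
by rewrite exprS mulrS log_embeddingM ?expf_neq0 // IHn.
Qed.

Lemma log_embeddingXz (x : K) (n : int) : x != 0 -> l (x ^ n) = l x *~ n.
Proof.
move=> nz_x; case: n => n; first exact: log_embeddingXn.
rewrite NegzE -invr_expz log_embeddingV ?expfz_neq0 // mulrNz.
by congr (- _); apply: log_embeddingXn.
Qed.

Lemma log_embedding_torsion (z : K) (n : nat) : (0 < n)%N -> z ^+ n = 1 -> l z = 0.
Proof.
move=> n_gt0 zn1; have nz_z : z != 0.
  by rewrite -[z == 0](andTb) -n_gt0 -expf_eq0 zn1 oner_neq0.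
have /eqP := log_embeddingXn n nz_z.
rewrite zn1 log_embedding1 eq_sym => /eqP ln0; apply/rowP=> k.
move/rowP/(_ k)/eqP: ln0; rewrite !mxE.
by rewrite mulmxnE mulrn_eq0 gtn_eqF //= mxE => /eqP.
Qed.

Lemma sum_log_embedding (x : K) :
  embedding_system r1 sigma -> x != 0 -> \sum_k l x 0 k = ln (abs_norm R x).
Proof.
move=> sigmaP nz_x; rewrite (abs_norm_places _ sigmaP).
have -> : ln (\prod_k Normc.normc (sigma k x) ^+ place_degree r1 k) =
    \sum_k ln (Normc.normc (sigma k x) ^+ place_degree r1 k).
  (* Positivity is carried along because [ln] is additive only on products of positive factors. *)
  pose Q (a b : R) := 0 < a /\ ln a = b.
  suff [] : Q (\prod_k Normc.normc (sigma k x) ^+ place_degree r1 k)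
    (\sum_k ln (Normc.normc (sigma k x) ^+ place_degree r1 k)) by [].
  apply: (big_ind2 Q) => [|a a' b b' [a0 <-] [b0 <-]|k _]; rewrite /Q.
  - by rewrite ltr01 ln1.
  - by rewrite mulr_gt0 // lnM.
  - by rewrite exprn_gt0 // normc_embedding_gt0.
apply: eq_bigr => k _; rewrite mxE lnXn ?normc_embedding_gt0 //.
by rewrite mulr_natl.
Qed.

Lemma sum_log_unit (x : K) :
  embedding_system r1 sigma -> integer_unit x -> \sum_k l x 0 k = 0.
Proof.
move=> sigmaP x_unit; have [nz_x _ _] := x_unit.
rewrite sum_log_embedding // /abs_norm.
by rewrite integer_unit_norm // rmorph1 ln1.
Qed.

(** The torsion factor has zero logarithm and the exponents become the coefficients. *)
Lemma log_unit (u : 'I_r -> K) (v : K) :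
    generates_units_mod_torsion u -> integer_unit v ->
  exists e : 'rV[int]_r, l v = map_mx intr e *m matL r1 sigma u.
Proof.
move=> [u_unit u_gen] /u_gen[e [n [z [n_gt0 zn1 ->]]]].
have nz_u i : u i != 0 by have [] := u_unit i.
have nz_z : z != 0.
  by rewrite -[z == 0](andTb) -n_gt0 -expf_eq0 zn1 oner_neq0.
exists (\row_i e i); have [nz_p l_p] : \prod_i u i ^ e i != 0 /\
    l (\prod_i u i ^ e i) = \sum_i l (u i) *~ e i.
  apply: (big_ind2 (fun y s => y != 0 /\ l y = s)) => [|a a' b b' [a0 <-] [b0 <-]|i _].
  - by rewrite oner_neq0 log_embedding1.
  - by rewrite mulf_neq0 // log_embeddingM.
  - by rewrite expfz_neq0 ?nz_u // log_embeddingXz ?nz_u.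
rewrite log_embeddingM // (log_embedding_torsion n_gt0 zn1) add0r l_p.
rewrite mulmx_sum_row; apply: eq_bigr => i _.
by rewrite rowK !mxE scaler_int.
Qed.

End LogEmbedding.

(** The logarithms [E] of the special units factor through the minor of [L], so it suffices to
    invert [E], which is diagonally dominant. *)
Lemma matL_minor_unitmx (R : realType) (K : fieldExtType rat) (r1 r : nat)
    (sigma : 'I_r.+1 -> {rmorphism K -> R[i]}) (u : 'I_r -> K) :
    embedding_system r1 sigma -> generates_units_mod_torsion u ->
  (col' ord_max (matL r1 sigma u) : 'M[R]_r) \in unitmx.
Proof.
move=> sigmaP u_gen.
have /choice[y yP] (k : 'I_r) : exists y : K, integer_unit y /\
    forall j, j != lift ord_max k -> Normc.normc (sigma j y) < 1.
  exact: unit_small_at_other_places (lift ord_max k) sigmaP.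
have /choice[e eP] k : exists e : 'rV[int]_r,
    log_embedding r1 sigma (y k) = map_mx intr e *m matL r1 sigma u.
  by apply: log_unit u_gen _; case: (yP k).
pose A : 'M[R]_r := \matrix_(k, j) (e k 0 j)%:~R.
pose E : 'M[R]_r := \matrix_(k, j) log_embedding r1 sigma (y k) 0 (lift ord_max j).
have def_E : E = A *m col' ord_max (matL r1 sigma u).
  apply/matrixP=> k j; rewrite !mxE -log_embeddingE eP !mxE.
  by apply: eq_bigr => i _; rewrite !mxE.
have log_lt0 k j : j != lift ord_max k -> log_embedding r1 sigma (y k) 0 j < 0.
  move=> ne_jk; rewrite log_embeddingE pmulr_rlt0 ?ltr0n ?place_degree_gt0 //.
  have [[nz_y _ _] /(_ j ne_jk) lt1] := yP k.
  by rewrite ln_lt0 // normc_embedding_gt0.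
suff: E \in unitmx by rewrite def_E unitmx_mul => /andP[].
apply: diagonally_dominant_unitmx => [k j ne_jk|k].
  by rewrite mxE ltW // log_lt0 // (inj_eq lift_inj).
(* The logarithms over all places sum to 0. The last place is never the exceptional one, so the
   entry left out of [E] is negative and the remaining row sum is positive. *)
have [y_unit _] := yP k; have := sum_log_unit sigmaP y_unit.
rewrite big_ord_recr /= => /eqP; rewrite addr_eq0 => /eqP sum_eq.
rewrite (eq_bigr (fun j => log_embedding r1 sigma (y k) 0 (widen_ord (leqnSn r) j))).
  by rewrite sum_eq oppr_gt0 log_lt0 // neq_lift.
move=> j _; rewrite mxE; congr (log_embedding _ _ _ _ _); apply: val_inj.
by rewrite /= /bump leqNgt ltn_ord.
Qed.

(** * The search range *)

(** Counted from the ceiling of its lower end, each coordinate is an integer between 0 and the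
    integer part [N] of [w], which leaves at most [N.+1] choices. *)
Lemma card_int_box (R : realType) (r : nat) (lo hi : 'rV[R]_r) (w : R) :
    0 <= w -> (forall j, hi 0 j - lo 0 j <= w) ->
  let S := [set U : 'rV[int]_r |
    forall j, lo 0 j <= (U 0 j)%:~R /\ (U 0 j)%:~R <= hi 0 j] in
  finite_set S /\ (#|` fset_set S|%fset)%:R <= (w + 1) ^+ r.
Proof.
move=> w_ge0 hi_lo S; pose N := Num.truncn w.
pose base j := Num.ceil (lo 0 j).
have S_base U j : S U -> 0 <= U 0 j - base j.
  by move=> /(_ j)[lo_U _]; rewrite subr_ge0 /base ceil_le_int.
have S_lt U j : S U -> (`|(U 0 j - base j)%R| < N.+1)%N.
  move=> SU; have [_ U_hi] := SU j; rewrite ltnS /N truncn_ge_nat //.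
  rewrite -[X in X <= _]/(`|(U 0 j - base j)%R|%N%:Z%:~R) gez0_abs ?S_base //.
  rewrite intrB; apply: le_trans (hi_lo j); apply: lerB => //.
  exact: ceil_ge.
pose key (U : 'rV[int]_r) : {ffun 'I_r -> 'I_N.+1} :=
  [ffun j => inord `|(U 0 j - base j)%R|%N].
have key_inj U V : S U -> S V -> key U = key V -> U = V.
  move=> SU SV /ffunP eq_key; apply/rowP => j.
  move/(congr1 (@nat_of_ord _)): (eq_key j); rewrite !ffunE !inordK ?S_lt // => eq_abs.
  apply: (addIr (- base j)).
  by rewrite -[LHS]gez0_abs ?S_base // eq_abs gez0_abs ?S_base.
pose point (g : {ffun 'I_r -> 'I_N.+1}) : 'rV[int]_r := \row_j ((g j)%:Z + base j).
have S_fin : finite_set S.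
  apply: (@sub_finite_set _ _ (point @` setT)); last first.
    by apply: finite_image; apply: finite_finset.
  move=> U SU; exists (key U) => //; apply/rowP => j.
  by rewrite mxE ffunE inordK ?S_lt // gez0_abs ?S_base // subrK.
split=> //; pose F := fset_set S.
have F_S (U : F) : S (val U).
  by apply/set_mem; rewrite -(in_fset_set S_fin); apply: valP.
have /leq_card : injective (fun U : F => key (val U)).
  by move=> U V /key_inj eq_UV; apply/val_inj/eq_UV.
rewrite card_ffun !card_ord -cardfE -(ler_nat R) natrX => /le_trans; apply.
rewrite lerXn2r ?nnegrE ?addr_ge0 // -natr1 lerD2r truncn_le //.
Qed.

(** The zero last row of [M] cancels the last column of [L]. *)
Lemma mulmx_matM (R : realType) (r : nat) (L : 'M[R]_(r, r.+1)) :
  (col' ord_max L : 'M[R]_r) \in unitmx -> L *m matM L = 1%:M.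
Proof.
move=> L_unit; rewrite -(mulmxV L_unit); apply/matrixP=> i j; rewrite !mxE.
rewrite (bigD1_ord ord_max) //= [matM L ord_max j]mxE unlift_none mulr0 add0r.
by apply: eq_bigr => k _; rewrite !mxE liftK.
Qed.

Section Search.

Variables (R : realType) (r : nat) (L : 'M[R]_(r, r.+1)) (X : 'rV[R]_r.+1).

Let minM (j : 'I_r) : R := \big[Num.min/matM L ord0 j]_k matM L k j.
Let maxM (j : 'I_r) : R := \big[Num.max/matM L ord0 j]_k matM L k j.

Hypothesis L_unit : (col' ord_max L : 'M[R]_r) \in unitmx.
Hypothesis L_sum : forall i, \sum_k L i k = 0.

(** Taking for [c] the column minima or maxima of [M] gives [matNplus] or [matNminus]. *)
Lemma mulmx_matM_shift (c : 'I_r -> R) :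
  L *m \matrix_(i, j) (matM L i j - c j) = 1%:M.
Proof.
rewrite -(mulmx_matM L_unit); apply/matrixP=> i j; rewrite !mxE.
transitivity (\sum_k L i k * matM L k j - (\sum_k L i k) * c j).
  2: by rewrite L_sum mul0r subr0.
rewrite mulr_suml -sumrB; apply: eq_bigr => k _.
by rewrite mxE mulrBr.
Qed.

Lemma search_range_complete (U : 'rV[int]_r) :
  passes_test L X U -> search_range L X U.
Proof.
move=> pass; have UXN c : (map_mx intr U *m L + X) *m (\matrix_(i, j) (matM L i j - c j)) =
    map_mx intr U + X *m (\matrix_(i, j) (matM L i j - c j)).
  by rewrite mulmxDl -mulmxA mulmx_matM_shift mulmx1.
split=> i j.
- rewrite mxE -subr_ge0 opprK.
  have -> : map_mx intr U i j + (X *m matNplus L) i j =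
      (map_mx intr U + X *m matNplus L) i j by rewrite [RHS]mxE.
  rewrite -UXN mxE sumr_ge0 // => k _; rewrite mulr_ge0 //.
    by have := pass i k; rewrite [in leLHS]mxE.
  by rewrite mxE subr_ge0 bigmin_le.
- rewrite [leRHS]mxE -subr_le0 opprK.
  have -> : map_mx intr U i j + (X *m matNminus L) i j =
      (map_mx intr U + X *m matNminus L) i j by rewrite [RHS]mxE.
  rewrite -UXN mxE sumr_le0 // => k _; rewrite mulr_ge0_le0 //.
    by have := pass i k; rewrite [in leLHS]mxE.
  by rewrite mxE subr_le0; apply: (le_bigmax _ (fun k => matM L k j)).
Qed.

Lemma search_range_width (j : 'I_r) :
  (- (X *m matNminus L)) 0 j - (- (X *m matNplus L)) 0 j =
  (maxM j - minM j) * \sum_k X 0 k.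
Proof.
rewrite !mxE opprK addrC -sumrB mulr_sumr; apply: eq_bigr => k _.
by rewrite [matNplus L k j]mxE [matNminus L k j]mxE /maxM /minM; ring.
Qed.

(** Column [j] of [M] is nonzero because [L M = 1], yet its last entry is 0, so it is not constant.
    Strictness makes the box empty when [X V < 0]. *)
Lemma matM_spread_gt0 (j : 'I_r) : 0 < maxM j - minM j.
Proof.
have last0 : matM L ord_max j = 0 by rewrite mxE unlift_none.
have [k nz_k] : exists k, matM L k j != 0.
  apply/existsP; apply: contraT; rewrite negb_exists => /forallP all0.
  have /matrixP/(_ j j)/eqP := mulmx_matM L_unit.
  rewrite mxE [_%:M _ _]mxE eqxx big1 => [|k _]; first by rewrite eq_sym oner_eq0.
  by have /negPn/eqP-> := all0 k; rewrite mulr0.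
have min_le i : minM j <= matM L i j by apply: bigmin_le.
have max_ge i : matM L i j <= maxM j by apply: (le_bigmax _ (fun i => matM L i j)).
rewrite subr_gt0; case: (ltgtP (matM L k j) 0) nz_k => // [lt0|gt0] _.
- by apply: le_lt_trans (min_le k) _; rewrite (lt_le_trans lt0) // -last0.
- by apply: le_lt_trans (lt_le_trans gt0 (max_ge k)); rewrite -last0.
Qed.

End Search.

Lemma search_range_box (R : realType) (r : nat) (L : 'M[R]_(r, r.+1))
    (X : 'rV[R]_r.+1) :
  search_range L X = [set U : 'rV[int]_r | forall j,
    (- (X *m matNplus L)) 0 j <= (U 0 j)%:~R /\
    (U 0 j)%:~R <= (- (X *m matNminus L)) 0 j].
Proof.
have UE (U : 'rV[int]_r) j : map_mx intr U 0 j = (U 0 j)%:~R :> R by rewrite mxE.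
apply/seteqP; split=> U /=.
  by move=> [lo hi] j; rewrite -UE.
by move=> box; split=> i j; rewrite (ord1 i) UE; case: (box j).
Qed.

Theorem proposition4p4 (R : realType) (K : fieldExtType rat)
    (d r1 r2 r : nat)
    (deg_K : \dim {:K} = d)
    (places : (r1 + r2 = r.+1)%N)
    (sigma : 'I_r.+1 -> {rmorphism K -> R[i]})
    (sigma_embeddings : embedding_system r1 sigma)
    (u : 'I_r -> K)
    (u_generators : generates_units_mod_torsion u) :
  let L := matL r1 sigma u in
  (forall (x : K) (B : R), x != 0 -> 0 < B ->
     let X := vecX r1 sigma x B in
     finite_set (search_range L X) /\
     algorithm_output L X = [set U : 'rV[int]_r | passes_test L X U]) /\
  (exists C : R, 0 < C /\
     forall (x : K) (B : R), x != 0 -> 0 < B ->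
       let X := vecX r1 sigma x B in
       (#|` fset_set (search_range L X)|%fset)%:R <=
         C * Num.max 0 (ln (abs_norm R x) - d%:R * ln B + 1) ^+ r).
Proof.
move=> L.
have L_unit : (col' ord_max L : 'M[R]_r) \in unitmx by apply: matL_minor_unitmx.
have L_sum i : \sum_k L i k = 0.
  apply: etrans (sum_log_unit sigma_embeddings (u_generators.1 i)).
  by apply: eq_bigr => k _; rewrite !mxE.
pose spread (j : 'I_r) : R := \big[Num.max/matM L ord0 j]_k matM L k j -
  \big[Num.min/matM L ord0 j]_k matM L k j.
have spread_gt0 j : 0 < spread j by apply: matM_spread_gt0.
pose c := \sum_j spread j.
have c_ge0 : 0 <= c by apply: sumr_ge0 => j _; apply: ltW.
have spread_le j : spread j <= c.
  by rewrite /c (bigD1 j) //= lerDl sumr_ge0 // => i _; apply: ltW.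
have sumX x B : x != 0 -> \sum_k vecX r1 sigma x B 0 k = ln (abs_norm R x) - d%:R * ln B.
  move=> nz_x; rewrite -(sum_log_embedding sigma_embeddings nz_x) -deg_K.
  rewrite -(sum_place_degree sigma_embeddings) natr_sum mulr_suml -sumrB.
  by apply: eq_bigr => k _; rewrite !mxE.
have width x B j : x != 0 -> let X := vecX r1 sigma x B in
    (- (X *m matNminus L)) 0 j - (- (X *m matNplus L)) 0 j =
    spread j * (ln (abs_norm R x) - d%:R * ln B).
  by move=> nz_x X; rewrite search_range_width sumX.
split=> [x B nz_x _ X|].
  split; last first.
    apply/seteqP; split=> [U [] //|U passU]; split=> //.
    exact: search_range_complete.
  rewrite search_range_box.
  (* Only finiteness is at stake here, so any common bound on the side lengths will do. *)
  pose w := \sum_j `|(- (X *m matNminus L)) 0 j - (- (X *m matNplus L)) 0 j|.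
  have [] := @card_int_box R r (- (X *m matNplus L)) (- (X *m matNminus L)) w => [|j|//].
    exact: sumr_ge0.
  by rewrite /w (bigD1 j) //= ler_wpDr ?ler_norm // sumr_ge0.
(* For [T >= 0] the sides have length at most [c * T], and [c * T + 1 <= (c + 1) * (T + 1)]. *)
exists ((c + 1) ^+ r); split; first by rewrite exprn_gt0 // ltr_wpDl.
move=> x B nz_x _ /=; set X := vecX _ _ _ _; set T := ln _ - _.
have [T_ge0|T_lt0] := leP 0 T.
  have cT_ge0 : 0 <= c * T by rewrite mulr_ge0.
  rewrite search_range_box.
  have [j|_] := card_int_box (lo := - (X *m matNplus L))
    (hi := - (X *m matNminus L)) cT_ge0.
    by rewrite width // ler_wpM2r.
  have T1_ge0 : 0 <= T + 1 by apply: addr_ge0.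
  move/le_trans; apply; rewrite max_r // -exprMn lerXn2r ?nnegrE //.
  - exact: addr_ge0.
  - by apply: mulr_ge0 => //; apply: addr_ge0.
  - by clearbody T; lra.
(* For [T < 0] and [r = 0] the empty vector is still tested, and the bound holds because a zeroth
   power is 1, even that of 0. *)
case: (posnP r) => [r0|r_gt0].
  have -> : (c + 1) ^+ r * Num.max 0 (T + 1) ^+ r = 1 by rewrite r0 !expr0 mulr1.
  rewrite search_range_box.
  have [j|_] := card_int_box (lo := - (X *m matNplus L))
    (hi := - (X *m matNminus L)) (lexx 0).
    by have := ltn_ord j; rewrite {2}r0.
  by rewrite add0r expr1n.
(* For [T < 0] and [r > 0] the first side of the box has negative length. *)
have -> : search_range L X = set0.
  apply/seteqP; split=> // U; rewrite search_range_box => /(_ (Ordinal r_gt0))[lo hi].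
  have := le_trans lo hi; rewrite -subr_ge0 width // leNgt => /negP; apply.
  by rewrite pmulr_rlt0.
rewrite fset_set0 cardfs0 mulr_ge0 ?exprn_ge0 ?le_max ?lexx //.
by rewrite addr_ge0.
Qed.
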